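(* Let $z \in \mathbb{C}$ with $z \neq 0, -1$. Then $$\beta(z)^2 = \xi(-z) + \mu(z),$$ that is, $\beta(z) \otimes \beta(z)$ is isomorphic to $\xi(-z) \oplus \mu(z)$, where $\mu(z)$ is a 3-dimensional representation of $B_3$ which is irreducible if $z^3 \neq 1$ and it is given by $$\sigma_1 \mapsto \begin{bmatrix} 1 & 0 & 0 \\ 0 & -z & 0 \\ 0 & 0 & z^2 \end{bmatrix}, \qquad \sigma_2 \mapsto \begin{bmatrix} \frac{z^4}{(z+1)^2} & \frac{z^2}{(z+1)^2}(z^2+z+1) & \frac{1}{(z+1)^2}(z^2+z+1)^2 \\ 2\frac{z^3}{(z+1)^2} & z\frac{z^2+1}{(z+1)^2} & -\frac{2}{(z+1)^2}(z^2+z+1) \\ \frac{z^2}{(z+1)^2} & -\frac{z}{(z+1)^2} & \frac{1}{(z+1)^2} \end{bmatrix}.$$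
   Context: The braid group $B_3$ is the group with generators $\sigma_1, \sigma_2$ and the single relation $\sigma_1\sigma_2\sigma_1 = \sigma_2\sigma_1\sigma_2$. A $k$-dimensional complex representation of $B_3$ is a group homomorphism $B_3 \to GL_k(\mathbb{C})$, where $GL_k(\mathbb{C})$ is the group of invertible complex $k \times k$ matrices. Two representations are isomorphic if they are conjugate by a fixed invertible matrix. A representation is called irreducible if it is not isomorphic to a direct sum of two lower dimensional representations; all 1-dimensional representations are irreducible by definition. For $w \in \mathbb{C}^*$, $\xi(w)$ denotes the 1-dimensional representation $\sigma_1, \sigma_2 \mapsto w$. For $z \in \mathbb{C}^*$, $\beta(z): B_3 \to GL_2(\mathbb{C})$ denotes the representation, called the irreducible Burau representation of $B_3$, given by $$\sigma_1 \mapsto \begin{bmatrix} -z & 0 \\ 1 & 1 \end{bmatrix}, \qquad \sigma_2 \mapsto \begin{bmatrix} 1 & z \\ 0 & -z \end{bmatrix}.$$ Products and sums of representations denote tensor products and direct sums, so $\beta(z)^2 = \beta(z) \otimes \beta(z)$. *)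

(* Defs.v *)
From HB Require Import structures.
From mathcomp Require Import all_boot all_order all_algebra.
From mathcomp Require Import boolp reals complex mxtens.
From mathcomp Require Import ring.

Set Implicit Arguments.
Unset Strict Implicit.
Unset Printing Implicit Defensive.

Import GRing.Theory.
Local Open Scope ring_scope.
Local Open Scope quotient_scope.

(* A letter (g, e) is the generator g, inverted when e is true, with
   g = false for sigma_1 and g = true for sigma_2. *)
Definition word : Type := seq (bool * bool).
HB.instance Definition _ := Choice.on word.

(* The least congruence on words that makes (g, e) and (g, ~~ e) mutually
   inverse and identifies the two sides of the braid relation. *)
Inductive braid_cong : word -> word -> Prop :=
| braid_refl u : braid_cong u u
| braid_sym u v : braid_cong u v -> braid_cong v u
| braid_trans u v w : braid_cong u v -> braid_cong v w -> braid_cong u w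
| braid_cat u u' v v' :
    braid_cong u u' -> braid_cong v v' -> braid_cong (u ++ v) (u' ++ v')
| braid_cancel g e : braid_cong [:: (g, e); (g, ~~ e)] [::]
| braid_rel : braid_cong [:: (false, false); (true, false); (false, false)]
                         [:: (true, false); (false, false); (true, false)].

Definition braid_congb : rel word := fun u v => `[< braid_cong u v >].

Lemma braid_congb_refl : reflexive braid_congb.
Proof. by move=> u; apply/asboolP/braid_refl. Qed.

Lemma braid_congb_sym : symmetric braid_congb.
Proof. by move=> u v; apply/asboolP/asboolP; apply: braid_sym. Qed.

Lemma braid_congb_trans : transitive braid_congb.
Proof.
by move=> v u w /asboolP uv /asboolP vw; apply/asboolP/(braid_trans uv vw).
Qed.

Canonical braid_equiv :=
  EquivRel braid_congb braid_congb_refl braid_congb_sym braid_congb_trans.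

Definition B3 : Type := {eq_quot braid_equiv}.
HB.instance Definition _ := Choice.on B3.
HB.instance Definition _ := EqQuotient.on B3.

Lemma B3_eqP (u v : word) : \pi_B3 u = \pi_B3 v <-> braid_cong u v.
Proof.
by split=> [/eqmodP/asboolP|uv] //; apply/eqmodP/asboolP.
Qed.

Definition word_inv (u : word) : word := rev [seq (l.1, ~~ l.2) | l <- u].

Lemma word_invK : involutive word_inv.
Proof.
move=> u; rewrite /word_inv map_rev revK -map_comp -[RHS]map_id.
by apply: eq_map => -[g e] /=; rewrite negbK.
Qed.

Lemma word_inv_cat (u v : word) : word_inv (u ++ v) = word_inv v ++ word_inv u.
Proof. by rewrite /word_inv map_cat rev_cat. Qed.

Lemma braid_mulV (u : word) : braid_cong (u ++ word_inv u) [::].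
Proof.
elim: u => [|[g e] u IH]; first exact: braid_refl.
rewrite -cat1s word_inv_cat -catA (catA u).
apply: braid_trans (braid_cancel g e).
exact: braid_cat (braid_refl [:: (g, e)]) (braid_cat IH (braid_refl _)).
Qed.

Lemma braid_Vmul (u : word) : braid_cong (word_inv u ++ u) [::].
Proof. by rewrite -{2}[u]word_invK; apply: braid_mulV. Qed.

Lemma braid_inv (u v : word) :
  braid_cong u v -> braid_cong (word_inv u) (word_inv v).
Proof.
move=> uv; have r := braid_refl.
have h1 : braid_cong (word_inv u ++ (v ++ word_inv v)) (word_inv u).
  by rewrite -[X in braid_cong _ X]cats0; apply: braid_cat (r _) (braid_mulV v).
apply: braid_trans (braid_sym h1) _; rewrite catA -[X in braid_cong _ X]cat0s.
apply: braid_cat (r _).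
exact: braid_trans (braid_cat (r _) (braid_sym uv)) (braid_Vmul u).
Qed.

Definition B3_mul (x y : B3) : B3 := \pi_B3 (repr x ++ repr y).
Definition B3_one : B3 := \pi_B3 [::].
Definition B3_inv (x : B3) : B3 := \pi_B3 (word_inv (repr x)).

Lemma braid_repr (u : word) : braid_cong (repr (\pi_B3 u)) u.
Proof. by apply/B3_eqP; rewrite reprK. Qed.

Lemma B3_mul_pi (u v : word) : B3_mul (\pi_B3 u) (\pi_B3 v) = \pi_B3 (u ++ v).
Proof. by apply/B3_eqP/braid_cat; apply: braid_repr. Qed.

Lemma B3_inv_pi (u : word) : B3_inv (\pi_B3 u) = \pi_B3 (word_inv u).
Proof. by apply/B3_eqP/braid_inv/braid_repr. Qed.

Lemma B3_mulA : associative B3_mul.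
Proof.
elim/quotW=> u; elim/quotW=> v; elim/quotW=> w.
by rewrite (B3_mul_pi v w) (B3_mul_pi u v) !B3_mul_pi catA.
Qed.

Lemma B3_mul1 : left_id B3_one B3_mul.
Proof. by elim/quotW=> u; rewrite B3_mul_pi. Qed.

Lemma B3_mulr1 : right_id B3_one B3_mul.
Proof. by elim/quotW=> u; rewrite B3_mul_pi cats0. Qed.

Lemma B3_mulVg : left_inverse B3_one B3_inv B3_mul.
Proof.
elim/quotW=> u; rewrite B3_inv_pi B3_mul_pi.
by apply/B3_eqP; apply: braid_Vmul.
Qed.

Lemma B3_mulgV : right_inverse B3_one B3_inv B3_mul.
Proof.
elim/quotW=> u; rewrite B3_inv_pi B3_mul_pi.
by apply/B3_eqP; apply: braid_mulV.
Qed.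

HB.instance Definition _ :=
  isGroup.Build B3 B3_mulA B3_mul1 B3_mulr1 B3_mulVg B3_mulgV.

Definition sigma1 : B3 := \pi_B3 [:: (false, false)].
Definition sigma2 : B3 := \pi_B3 [:: (true, false)].

Lemma braid_relation :
  (sigma1 * sigma2 * sigma1 = sigma2 * sigma1 * sigma2)%g.
Proof.
have piM (u v : word) : (\pi_B3 u * \pi_B3 v)%g = \pi_B3 (u ++ v).
  exact: B3_mul_pi.
rewrite (piM [:: (false, false)] [:: (true, false)]).
rewrite (piM [:: (true, false)] [:: (false, false)]).
rewrite (piM [:: _; _] [:: (false, false)]) (piM [:: _; _] [:: (true, false)]).
by apply/B3_eqP; apply: braid_rel.
Qed.

(* A homomorphism B3 -> GL_k(F): the two equations force every matrix to be
   invertible (rep_unitmx). *)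
Record rep (F : fieldType) (k : nat) := Rep {
  rep_mx :> B3 -> 'M[F]_k;
  rep1 : rep_mx 1%g = 1%:M;
  repM : {morph rep_mx : x y / (x * y)%g >-> x *m y}
}.

Lemma rep_unitmx (F : fieldType) (k : nat) (r : rep F k) (x : B3) :
  r x \in unitmx.
Proof.
suff /mulmx1_unit[] : r x *m r x^-1%g = 1%:M by [].
by rewrite -repM mulgV rep1.
Qed.

Definition rep_iso (F : fieldType) (k : nat) (r s : rep F k) : Prop :=
  exists2 P : 'M[F]_k, P \in unitmx & forall x, s x = invmx P *m r x *m P.

Section Operations.
Variables (F : fieldType) (k l : nat) (r : rep F k) (s : rep F l).

Fact dsum_rep1 : block_mx (r 1%g) 0 0 (s 1%g) = 1%:M.
Proof. by rewrite !rep1 -scalar_mx_block. Qed.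

Fact dsum_repM :
  {morph (fun x => block_mx (r x) 0 0 (s x)) :
     x y / (x * y)%g >-> x *m y}.
Proof.
move=> x y; rewrite /= mulmx_block !repM.
by rewrite !(mulmx0, mul0mx, addr0, add0r).
Qed.

Definition dsum_rep : rep F (k + l) := Rep dsum_rep1 dsum_repM.

Fact tens_rep1 : r 1%g *t s 1%g = 1%:M.
Proof.
rewrite !rep1; apply/matrixP => i j.
case: (mxtens_indexP i) => i0 i1; case: (mxtens_indexP j) => j0 j1.
rewrite tensmxE !mxE -natrM mulnb; congr ((_ : bool)%:R).
by rewrite (can_eq (@mxtens_indexK _ _)) xpair_eqE.
Qed.

Fact tens_repM :
  {morph (fun x => r x *t s x) : x y / (x * y)%g >-> x *m y}.
Proof. by move=> x y; rewrite /= tensmx_mul !repM. Qed.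

Definition tens_rep : rep F (k * l) := Rep tens_rep1 tens_repM.

End Operations.

(* Irreducible in the sense of direct sums, i.e. indecomposable; invariant
   subspaces without an invariant complement are allowed. For k = 1 it always
   holds (rep_irreducible1). The direct sum has dimension k1 + k2, which is
   only propositionally equal to k; ecast transports it along e. *)
Definition rep_irreducible (F : fieldType) (k : nat) (r : rep F k) : Prop :=
  ~ exists (k1 k2 : nat) (e : (k1 + k2)%N = k)
           (r1 : rep F k1) (r2 : rep F k2),
      [/\ (k1 < k)%N, (k2 < k)%N &
          rep_iso r (ecast n (rep F n) e (dsum_rep r1 r2))].

Lemma rep_irreducible1 (F : fieldType) (r : rep F 1) : rep_irreducible r.
Proof. by move=> [[|k1] [[|k2] [e [r1 [r2 [//]]]]]]. Qed.

Section FromGenerators.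
Variables (F : fieldType) (k : nat) (A B : 'M[F]_k).
Hypotheses (Au : A \in unitmx) (Bu : B \in unitmx).
Hypothesis AB : A *m B *m A = B *m A *m B.

Definition letter_mx (l : bool * bool) : 'M[F]_k :=
  let M := if l.1 then B else A in if l.2 then invmx M else M.

Definition word_mx (u : word) : 'M[F]_k :=
  foldr (fun l M => letter_mx l *m M) 1%:M u.

Lemma word_mx_cat (u v : word) : word_mx (u ++ v) = word_mx u *m word_mx v.
Proof.
by elim: u => [|l u IH] /=; rewrite ?mul1mx // IH mulmxA.
Qed.

Lemma word_mx_cong (u v : word) : braid_cong u v -> word_mx u = word_mx v.
Proof.
elim=> //=.
- by move=> ? ? ? _ -> _.
- by move=> ? ? ? ? _ Eu _ Ev; rewrite !word_mx_cat Eu Ev.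
- by move=> [] [] /=; rewrite /letter_mx /= mulmx1 ?mulVmx ?mulmxV.
- by rewrite /letter_mx /= !mulmx1 !mulmxA.
Qed.

Definition gen_mx (x : B3) : 'M[F]_k := word_mx (repr x).

Lemma gen_mx_pi (u : word) : gen_mx (\pi_B3 u) = word_mx u.
Proof. exact/word_mx_cong/braid_repr. Qed.

Fact gen_mx1 : gen_mx 1%g = 1%:M.
Proof. exact: gen_mx_pi. Qed.

Fact gen_mxM : {morph gen_mx : x y / (x * y)%g >-> x *m y}.
Proof. by move=> x y; rewrite gen_mx_pi word_mx_cat. Qed.

Definition rep_of_gens : rep F k := Rep gen_mx1 gen_mxM.

Lemma rep_of_gens1 : rep_of_gens sigma1 = A.
Proof. by rewrite /= gen_mx_pi /= mulmx1. Qed.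

Lemma rep_of_gens2 : rep_of_gens sigma2 = B.
Proof. by rewrite /= gen_mx_pi /= mulmx1. Qed.

End FromGenerators.

Definition mx_of_rows (F : fieldType) (k : nat) (rows : seq (seq F)) :
  'M[F]_k := \matrix_(i, j) nth 0 (nth [::] rows i) j.

Section XiBeta.
Variable F : fieldType.

Fact scalar_unit (w : F) : w != 0 -> (w%:M : 'M[F]_1) \in unitmx.
Proof. by move=> w0; rewrite unitmxE det_scalar1 unitfE. Qed.

Definition xi (w : F) (w0 : w != 0) : rep F 1 :=
  rep_of_gens (scalar_unit w0) (scalar_unit w0) erefl.

Definition beta1 (z : F) : 'M[F]_2 := mx_of_rows 2
  [:: [:: - z; 0];
      [:: 1;   1]].

Definition beta2 (z : F) : 'M[F]_2 := mx_of_rows 2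
  [:: [:: 1; z  ];
      [:: 0; - z]].

Fact beta1_unit (z : F) : z != 0 -> beta1 z \in unitmx.
Proof.
move=> z0; rewrite unitmxE det_trig; last first.
  by apply/is_trig_mxP => -[[|[|//]] i] [[|[|//]] j] //; rewrite mxE.
by rewrite big_ord_recl big_ord1 !mxE /= mulr1 unitfE oppr_eq0.
Qed.

Fact beta2_unit (z : F) : z != 0 -> beta2 z \in unitmx.
Proof.
move=> z0; rewrite -unitmx_tr unitmxE det_trig; last first.
  by apply/is_trig_mxP => -[[|[|//]] i] [[|[|//]] j] //; rewrite !mxE.
by rewrite big_ord_recl big_ord1 !mxE /= mul1r unitfE oppr_eq0.
Qed.

Fact beta_braid (z : F) :
  beta1 z *m beta2 z *m beta1 z = beta2 z *m beta1 z *m beta2 z.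
Proof.
apply/matrixP => -[[|[|//]] i] [[|[|//]] j];
  rewrite !mxE !big_ord_recl !big_ord0 !mxE !big_ord_recl !big_ord0 !mxE /=;
  ring.
Qed.

Definition beta (z : F) (z0 : z != 0) : rep F 2 :=
  rep_of_gens (beta1_unit z0) (beta2_unit z0) (beta_braid z).

Lemma oppr_neq0 (z : F) : z != 0 -> - z != 0.
Proof. by rewrite oppr_eq0. Qed.

Definition mu1 (z : F) : 'M[F]_3 := mx_of_rows 3
  [:: [:: 1; 0;   0     ];
      [:: 0; - z; 0     ];
      [:: 0; 0;   z ^+ 2]].

Definition mu2 (z : F) : 'M[F]_3 :=
  let q := z ^+ 2 + z + 1 in
  let d := (z + 1) ^+ 2 in
  mx_of_rows 3
  [:: [:: z ^+ 4 / d;       z ^+ 2 / d * q;         1 / d * q ^+ 2];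
      [:: 2 * (z ^+ 3 / d); z * ((z ^+ 2 + 1) / d); - (2 / d * q) ];
      [:: z ^+ 2 / d;       - (z / d);              1 / d         ]].

End XiBeta.

Arguments xi {F} w w0.
Arguments beta {F} z z0.

(* Main.v *)
Require Import Defs.
From mathcomp Require Import all_boot all_order all_algebra.
From mathcomp Require Import reals complex.
From mathcomp Require Import mxtens ring.

(** The flip symmetry splits the tensor square of [beta z] into its exterior
    square, on which B3 acts by the determinant [- z], and its symmetric
    square. The matrices of [mu z] are those of the symmetric square in the
    basis [u * u], [- (u * w + w * u) / 2], [w * w], where [u = (0, 1)] and
    [w = (z + 1, - 1)] are eigenvectors of sigma_1.

    If [z ^ 3 != 1], a matrix that commutes with sigma_1 is diagonal, since
    the eigenvalues [1], [- z], [z ^ 2] are distinct; if it also commutes with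
    sigma_2 it is scalar, since the first row of sigma_2 has no zero entry.
    The projections of a direct sum decomposition would be non-scalar
    commuting matrices. *)

Set Implicit Arguments.
Unset Strict Implicit.
Unset Printing Implicit Defensive.

Import GRing.Theory.

Local Open Scope quotient_scope.
Local Open Scope ring_scope.

Lemma rep_inv (F : fieldType) (k : nat) (r : rep F k) (x : B3) :
  r x^-1%g = invmx (r x).
Proof.
apply: (can_inj (mulKmx (rep_unitmx r x))).
by rewrite -repM mulgV rep1 mulmxV ?rep_unitmx.
Qed.

(** Every word is a product of letters, and each letter is a generator or the inverse of one. *)
Lemma B3_ind (Q : B3 -> Prop) :
  Q 1%g -> (forall x y, Q x -> Q y -> Q (x * y)%g) ->
  (forall x, Q x -> Q x^-1%g) -> Q sigma1 -> Q sigma2 -> forall x, Q x.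
Proof.
move=> Q1 QM QV Qs1 Qs2; elim/quotW; elim=> [|l u IHu]; first exact: Q1.
suff Ql : Q (\pi_B3 [:: l]) by rewrite -cat1s -B3_mul_pi; apply: QM.
have QVl g : Q (\pi_B3 [:: (g, false)]) -> Q (\pi_B3 [:: (g, true)]).
  by move/QV; rewrite [X in Q X]B3_inv_pi.
by case: l => -[] []; first [exact: Qs1 | exact: Qs2 | exact: QVl].
Qed.

(** [A] and [C] are bare matrices, so that this applies to [mu1] and [mu2] before they are known to
    define a representation. *)
Lemma intertwinerM (F : fieldType) (k : nat) (r : rep F k) (x y : B3)
    (P A C : 'M[F]_k) :
  r x *m P = P *m A -> r y *m P = P *m C -> r (x * y)%g *m P = P *m (A *m C).
Proof. by move=> Ex Ey; rewrite repM -mulmxA Ey mulmxA Ex mulmxA. Qed.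

Lemma rep_iso_gens (F : fieldType) (k : nat) (r s : rep F k) (P : 'M[F]_k) :
  P \in unitmx ->
  r sigma1 *m P = P *m s sigma1 -> r sigma2 *m P = P *m s sigma2 ->
  rep_iso r s.
Proof.
move=> Pu E1 E2; exists P => // x.
rewrite -mulmxA; apply: (can_inj (mulKmx Pu)); rewrite mulKVmx //; symmetry.
elim/B3_ind: x => //.
- by rewrite !rep1 mul1mx mulmx1.
- by move=> x y Ex Ey; rewrite (repM s); apply: intertwinerM.
- move=> x Ex; apply: (can_inj (mulKmx (rep_unitmx r x))).
  rewrite !rep_inv mulKVmx ?rep_unitmx // mulmxA Ex.
  by rewrite mulmxK ?rep_unitmx.
Qed.

Lemma scalar_commutant_irreducible (F : fieldType) (k : nat) (r : rep F k) :
  (forall E : 'M[F]_k, (forall x, E *m r x = r x *m E) -> is_scalar_mx E) ->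
  rep_irreducible r.
Proof.
move=> scal [k1 [k2 [e [r1 [r2 [lt1 lt2]]]]]].
(* Replacing [k] by [k1 + k2] makes the transport along [e] the identity. *)
case: _ / e in r scal lt1 lt2 * => -[P Pu defs].
pose D : 'M[F]_(k1 + k2) := block_mx 1%:M 0 0 0.
have DC x : D *m dsum_rep r1 r2 x = dsum_rep r1 r2 x *m D.
  by rewrite /= !mulmx_block !(mul0mx, mulmx0, mul1mx, mulmx1, addr0).
have /scal/is_scalar_mxP[a Ea] x :
    (P *m D *m invmx P) *m r x = r x *m (P *m D *m invmx P).
  have -> : r x = P *m dsum_rep r1 r2 x *m invmx P.
    by rewrite defs !mulmxA mulmxV // mul1mx mulmxK.
  by rewrite !mulmxA !mulmxKV // -!(mulmxA P) DC.
have Da : D = a%:M.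
  rewrite -[D](mulKmx Pu) -[P *m D](mulmxKV Pu) Ea -scalar_mxC mulmxA.
  by rewrite mulVmx // mul1mx.
(* Each summand is smaller than the whole, so the other is nonzero: the diagonal of [D] contains
   both 1 and 0. *)
have l2 : (0 < k2)%N by rewrite -(ltn_add2l k1) addn0.
have l1 : (0 < k1)%N by rewrite -(ltn_add2r k2) add0n.
have /matrixP/(_ (lshift k2 (Ordinal l1)) (lshift k2 (Ordinal l1))) := Da.
have /matrixP/(_ (rshift k1 (Ordinal l2)) (rshift k1 (Ordinal l2))) := Da.
rewrite block_mxEul block_mxEdr !mxE !eqxx !mulr1n => <- /eqP.
by rewrite oner_eq0.
Qed.

Section SymmetricSquare.
Variables (F : fieldType) (z : F).

(** The antisymmetric tensor of the two standard basis vectors, with pairs of indices in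
    lexicographic order. *)
Definition alt_basis : 'M[F]_(2 * 2, 1) := \matrix_(i, j)
  nth 0 [:: 0; 1; - 1; 0] i.

Definition sym_basis : 'M[F]_(2 * 2, 3) := \matrix_(i, j)
  nth 0 (nth [::]
    [:: [:: 0; 0;               (z + 1) ^+ 2];
        [:: 0; - ((z + 1) / 2); - (z + 1)   ];
        [:: 0; - ((z + 1) / 2); - (z + 1)   ];
        [:: 1; 1;               1           ]] i) j.

Definition alt_coord : 'M[F]_(1, 2 * 2) := \matrix_(i, j)
  nth 0 [:: 0; 1 / 2; - (1 / 2); 0] j.

(** The rows are [a * a], [- (a * b + b * a)], [b * b], where [a], [b] is the basis dual to [u],
    [w]. *)
Definition sym_coord : 'M[F]_(3, 2 * 2) := \matrix_(i, j)
  nth 0 (nth [::]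
    [:: [:: 1 / (z + 1) ^+ 2;    1 / (z + 1);    1 / (z + 1);    1];
        [:: - (2 / (z + 1) ^+ 2); - (1 / (z + 1)); - (1 / (z + 1)); 0];
        [:: 1 / (z + 1) ^+ 2;    0;              0;              0]] i) j.

Hypotheses (two0 : 2 != 0 :> F) (z10 : z + 1 != 0).

Let basis_mx : 'M[F]_(1 + 3) := row_mx alt_basis sym_basis.
Let coord_mx : 'M[F]_(1 + 3) := col_mx alt_coord sym_coord.

Lemma alt_basisK : alt_coord *m alt_basis = 1%:M.
Proof.
apply/matrixP => -[[|//] i] [[|//] j].
by rewrite !mxE !big_ord_recl !big_ord0 !mxE /=; field.
Qed.

Lemma sym_basisK : sym_coord *m sym_basis = 1%:M.
Proof.
apply/matrixP => -[[|[|[|//]]] i] [[|[|[|//]]] j];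
  rewrite !mxE !big_ord_recl !big_ord0 !mxE /=; field; rewrite ?z10 ?two0 //.
Qed.

Lemma alt_sym_coord : alt_coord *m sym_basis = 0.
Proof.
apply/matrixP => -[[|//] i] [[|[|[|//]]] j];
  rewrite !mxE !big_ord_recl !big_ord0 !mxE /=; field; rewrite ?z10 ?two0 //.
Qed.

Lemma sym_alt_coord : sym_coord *m alt_basis = 0.
Proof.
apply/matrixP => -[[|[|[|//]]] i] [[|//] j];
  rewrite !mxE !big_ord_recl !big_ord0 !mxE /=; field; rewrite ?z10 ?two0 //.
Qed.

Lemma basis_mx_unit : basis_mx \in unitmx.
Proof.
suff /mulmx1_unit[] : coord_mx *m basis_mx = 1%:M by [].
rewrite mul_col_row alt_basisK sym_basisK alt_sym_coord sym_alt_coord.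
by rewrite -scalar_mx_block.
Qed.

Lemma beta1_alt : (beta1 z *t beta1 z) *m alt_basis = alt_basis *m (- z)%:M.
Proof.
apply/matrixP => -[[|[|[|[|//]]]] i] [[|//] j];
  rewrite !mxE !big_ord_recl !big_ord0 !mxE /=; ring.
Qed.

Lemma beta2_alt : (beta2 z *t beta2 z) *m alt_basis = alt_basis *m (- z)%:M.
Proof.
apply/matrixP => -[[|[|[|[|//]]]] i] [[|//] j];
  rewrite !mxE !big_ord_recl !big_ord0 !mxE /=; ring.
Qed.

Lemma beta1_sym : (beta1 z *t beta1 z) *m sym_basis = sym_basis *m mu1 z.
Proof.
apply/matrixP => -[[|[|[|[|//]]]] i] [[|[|[|//]]] j];
  rewrite !mxE !big_ord_recl !big_ord0 !mxE /=; field; rewrite ?z10 ?two0 //.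
Qed.

Lemma beta2_sym : (beta2 z *t beta2 z) *m sym_basis = sym_basis *m mu2 z.
Proof.
apply/matrixP => -[[|[|[|[|//]]]] i] [[|[|[|//]]] j];
  rewrite !mxE !big_ord_recl !big_ord0 !mxE /=; field; rewrite ?z10 ?two0 //.
Qed.

Hypothesis z0 : z != 0.

(* The dimension is written 1 + 3, convertible to 2 * 2, so that the lemmas on
   block matrices unify. *)
Let beta_sq : rep F (1 + 3) := tens_rep (beta z z0) (beta z z0).

Lemma beta_sq1 :
  beta_sq sigma1 *m basis_mx = basis_mx *m block_mx (- z)%:M 0 0 (mu1 z).
Proof.
rewrite [beta_sq _]/(_ *t _) rep_of_gens1 mul_mx_row beta1_alt beta1_sym.
by rewrite mul_row_block !mulmx0 addr0 add0r.
Qed.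

Lemma beta_sq2 :
  beta_sq sigma2 *m basis_mx = basis_mx *m block_mx (- z)%:M 0 0 (mu2 z).
Proof.
rewrite [beta_sq _]/(_ *t _) rep_of_gens2 mul_mx_row beta2_alt beta2_sym.
by rewrite mul_row_block !mulmx0 addr0 add0r.
Qed.

(** The block matrix is conjugate to an invertible one and its determinant is the product of those
    of its blocks. This makes [mu1 z] and [mu2 z] invertible without computing their
    determinants. *)
Lemma intertwined_block_unit (x : B3) (M : 'M[F]_3) :
  beta_sq x *m basis_mx = basis_mx *m block_mx (- z)%:M 0 0 M -> M \in unitmx.
Proof.
move/(congr1 (fun A => A \in unitmx)); rewrite !unitmx_mul rep_unitmx.
rewrite basis_mx_unit [X in _ = X -> _]unitmxE det_ublock unitrM.
by rewrite -unitmxE => /esym/andP[].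
Qed.

(** The two sides are the lower right blocks of one group element, written in two ways, acting on
    the tensor square in the new basis. *)
Lemma mu_braid : mu1 z *m mu2 z *m mu1 z = mu2 z *m mu1 z *m mu2 z.
Proof.
have := intertwinerM (intertwinerM beta_sq2 beta_sq1) beta_sq2.
rewrite -braid_relation (intertwinerM (intertwinerM beta_sq1 beta_sq2) beta_sq1).
move/(can_inj (mulKmx basis_mx_unit)); rewrite !mulmx_block.
rewrite !(mul0mx, mulmx0, addr0, add0r).
by case/eq_block_mx.
Qed.

Lemma mu1_unit : mu1 z \in unitmx.
Proof. exact: intertwined_block_unit beta_sq1. Qed.

Lemma mu2_unit : mu2 z \in unitmx.
Proof. exact: intertwined_block_unit beta_sq2. Qed.

Definition mu : rep F 3 := rep_of_gens mu1_unit mu2_unit mu_braid.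

Lemma beta_sq_iso : rep_iso beta_sq (dsum_rep (xi (- z) (oppr_neq0 z0)) mu).
Proof.
apply: (rep_iso_gens basis_mx_unit).
- rewrite beta_sq1 [dsum_rep _ _ _]/(block_mx _ 0 0 _).
  by rewrite !rep_of_gens1.
- rewrite beta_sq2 [dsum_rep _ _ _]/(block_mx _ 0 0 _).
  by rewrite !rep_of_gens2.
Qed.

End SymmetricSquare.

(** Comparing entries gives [(d 0 j - d 0 i) * E i j = 0]. *)
Lemma comm_diag_mx (F : fieldType) (k : nat) (d : 'rV[F]_k) (E : 'M[F]_k) :
  injective (d 0) -> E *m diag_mx d = diag_mx d *m E -> is_diag_mx E.
Proof.
move=> d_inj /matrixP ED; apply/is_diag_mxP => i j ij.
have /eqP := ED i j; rewrite mul_mx_diag mul_diag_mx !mxE mulrC -subr_eq0.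
rewrite -mulrBl mulf_eq0 subr_eq0 (inj_eq d_inj) => /orP[/eqP ji|/eqP//].
by rewrite ji eqxx in ij.
Qed.

Lemma comm_diag_scalar (F : fieldType) (k : nat) (d : 'rV[F]_k.+1)
    (M : 'M[F]_k.+1) :
  (forall j, M 0 j != 0) -> diag_mx d *m M = M *m diag_mx d ->
  is_scalar_mx (diag_mx d).
Proof.
move=> M0 /matrixP dM; apply/is_scalar_mxP; exists (d 0 0).
rewrite -diag_const_mx; congr diag_mx; apply/rowP => j; rewrite mxE.
have := dM 0 j; rewrite mul_mx_diag mul_diag_mx !mxE mulrC.
by move/(mulfI (M0 j)).
Qed.

Lemma mu_irreducible (F : fieldType) (z : F) (r : rep F 3) :
  z != 0 -> z != -1 -> z ^+ 3 != 1 ->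
  r sigma1 = mu1 z -> r sigma2 = mu2 z -> rep_irreducible r.
Proof.
move=> z0 z1 z3 r1 r2; apply: scalar_commutant_irreducible => E Er.
have z10 : z + 1 != 0 by rewrite addr_eq0.
(* Both factors of [z ^ 3 - 1] matter: [z - 1] separates the eigenvalues 1 and [z ^ 2], while
   [z ^ 2 + z + 1] divides two entries of the first row of [mu2 z]. *)
have zn1 : z - 1 != 0.
  by apply: contraNneq z3 => /subr0_eq->; rewrite expr1n.
have q0 : z ^+ 2 + z + 1 != 0.
  apply: contraNneq z3 => q0; rewrite -subr_eq0.
  have -> : z ^+ 3 - 1 = (z - 1) * (z ^+ 2 + z + 1) by ring.
  by rewrite q0 mulr0.
pose d : 'rV[F]_3 := \row_j [:: 1; - z; z ^+ 2]`_j.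
have mu1E : mu1 z = diag_mx d.
  apply/matrixP => -[[|[|[|//]]] i] [[|[|[|//]]] j];
  by rewrite !mxE /= ?mulr1n ?mulr0n.
(* The differences of eigenvalues are, up to sign, [z + 1], [(z - 1) * (z + 1)] and
   [z * (z + 1)]. *)
have d01 : 1 != - z by rewrite eq_sym eqr_oppLR.
have d02 : 1 != z ^+ 2.
  by rewrite eq_sym -subr_eq0 -[1](expr1n _ 2) subr_sqr mulf_neq0.
have d12 : - z != z ^+ 2.
  by rewrite eq_sym -subr_eq0 opprK -[X in _ + X]mulr1 -mulrDr mulf_neq0.
have d_inj : injective (d 0).
  move=> [[|[|[|//]]] i] [[|[|[|//]]] j]; rewrite !mxE /= => /eqP dij;
  apply: val_inj => //=; move: dij;
  first [by rewrite ?(negPf d01) ?(negPf d02) ?(negPf d12)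
        |by rewrite eq_sym ?(negPf d01) ?(negPf d02) ?(negPf d12)].
have := Er sigma1; rewrite r1 mu1E => /(comm_diag_mx d_inj) /diag_mxP[c Ec].
have := Er sigma2; rewrite r2 Ec; apply: comm_diag_scalar.
move=> [[|[|[|//]]] i];
by rewrite mxE /= ?mulf_neq0 ?invr_eq0 ?expf_neq0 ?oner_neq0.
Qed.

Theorem proposition3 (R : realType) (z : R[i])
    (z0 : z != 0) (z1 : z != -1) :
  exists mu : rep R[i] 3,
    [/\ mu sigma1 = mu1 z,
        mu sigma2 = mu2 z,
        rep_iso (tens_rep (beta z z0) (beta z z0))
                (dsum_rep (xi (- z) (oppr_neq0 z0)) mu) &
        (z ^+ 3 != 1 -> rep_irreducible mu)].
Proof.
have z10 : z + 1 != 0 by rewrite addr_eq0.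
have two0 : 2 != 0 :> R[i] by rewrite Num.Theory.pnatr_eq0.
have m1 : mu two0 z10 z0 sigma1 = mu1 z by exact: rep_of_gens1.
have m2 : mu two0 z10 z0 sigma2 = mu2 z by exact: rep_of_gens2.
exists (mu two0 z10 z0); split => //; first exact: beta_sq_iso.
by move=> z3; apply: mu_irreducible m1 m2.
Qed.
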